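(* Let $p$ be a prime such that $p \bmod 9240$ is not one of the $34$ residues $$1, 169, 289, 361, 529, 841, 961, 1369, 1681, 1849, 2041, 2209, 2521, 2641, 2689, 2809, 3361,$$ $$3481, 3529, 3721, 4321, 4489, 5041, 5161, 5329, 5569, 6169, 6241, 6889, 7561, 7681, 7921, 8089, 8761.$$ Then there exist positive integers $x \le y \le z$ with $$\frac{4}{p} = \frac{1}{x} + \frac{1}{y} + \frac{1}{z} \quad\text{and}\quad x = \left\lfloor \frac{py}{4y-p} \right\rfloor + 1,$$ i.e. $p$ has at least one solution of type I(b).
   Context: For a prime $p$, a solution of $\frac{4}{p} = \frac{1}{x}+\frac{1}{y}+\frac{1}{z}$ is a triple of positive integers $(x,y,z)$ satisfying the equation, normalized so that $x \le y \le z$. A solution is of type I(b) if $x = \lfloor py/(4y-p)\rfloor + 1$. *)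

(* Defs.v *)
From mathcomp Require Import all_boot all_order all_algebra.

Set Implicit Arguments.
Unset Strict Implicit.
Unset Printing Implicit Defensive.

Import GRing.Theory Num.Theory.

Local Open Scope ring_scope.

Definition es_solution (p x y z : nat) : Prop :=
  [/\ [/\ (0 < x)%N, (0 < y)%N & (0 < z)%N],
      (x <= y <= z)%N &
      4%:R / p%:R = 1 / x%:R + 1 / y%:R + 1 / z%:R :> rat].

(* The quotient is taken in rat, so 4 y - p is not truncated. In any solution
   x > p / 4, hence y > p / 4 and the denominator is positive. *)
Definition type_Ib_solution (p x y z : nat) : Prop :=
  es_solution p x y z /\
  x%:Z = Num.floor ((p%:R * y%:R) / (4%:R * y%:R - p%:R) : rat) + 1.

Definition exceptional_residues : seq nat :=
  [:: 1; 169; 289; 361; 529; 841; 961; 1369; 1681; 1849; 2041; 2209; 2521;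
      2641; 2689; 2809; 3361; 3481; 3529; 3721; 4321; 4489; 5041; 5161; 5329;
      5569; 6169; 6241; 6889; 7561; 7681; 7921; 8089; 8761]%N.

(* Main.v *)
(* In the notation of [es_solution], write [x = a b d], [n = 4 x - p]. Then
   [4/p = 1/x + 1/y + 1/z] is solved by [y = p a c d, z = p b c d] if
   [n c = a + b], and by [y = a c d, z = p b c d] if [n c = a + p b]. The
   condition on the floor amounts to [(n - 4) y <= p (x - 1)], which in these two
   cases follows from [a < 4 c] and [a + 4 b <= 4 c] respectively. Suitable
   [n, a, b, c, d], polynomial in [k], on the progressions [p = m k + r] leave
   out only the exceptional residue classes modulo 9240 and classes divisible by
   one of 2, 3, 5, 7, 11. *)
From Stdlib Require Import NArith.
Require Import Defs.
From mathcomp Require Import all_boot all_order all_algebra.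
From mathcomp Require Import ring zify.

Set Implicit Arguments.
Unset Strict Implicit.
Unset Printing Implicit Defensive.

Import Order.TTheory GRing.Theory Num.Theory.

(** One half of the floor condition, [p * y < x * (4 * y - p)], is automatic since [1 / z > 0]. The
    last hypothesis is the other half, [(x - 1) * (4 * y - p) <= p * y], expanded so that no
    subtraction occurs. *)
Lemma type_Ib_of_nat (p x y z : nat) :
    0 < p -> 0 < x -> x <= y -> y <= z ->
    4 * (x * y * z) = p * (x * y + y * z + z * x) ->
    4 * (x * y) + p <= p * x + p * y + 4 * y ->
  type_Ib_solution p x y z.
Proof.
move=> p_gt0 x_gt0 le_xy le_yz Exyz le_bound.
have y_gt0 : 0 < y by lia.
have z_gt0 : 0 < z by lia.
have lt_p4y : p < 4 * y by nia.
have lt_px : p * y < x * (4 * y - p) by nia.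
have le_px : (x - 1) * (4 * y - p) <= p * y by nia.
split; first split.
- by split.
- by rewrite le_xy.
- have nz k : 0 < k -> (k%:R : rat)%R != 0%R by rewrite pnatr_eq0 -lt0n.
  have EQ : (4%:R * (x%:R * y%:R * z%:R) =
    p%:R * (x%:R * y%:R + y%:R * z%:R + z%:R * x%:R) :> rat)%R.
    by rewrite -!natrM -!natrD -natrM Exyz.
  have [[px nx] [ny nz']] := ((nz p p_gt0, nz x x_gt0), (nz y y_gt0, nz z z_gt0)).
  apply: (mulfI (mulf_neq0 px (mulf_neq0 (mulf_neq0 nx ny) nz'))).
  transitivity (4%:R * (x%:R * y%:R * z%:R) : rat)%R; first by field.
  by rewrite EQ; field; rewrite nx ny nz'.
- suff -> : (Num.floor ((p%:R * y%:R) / (4%:R * y%:R - p%:R) : rat) =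
             (x - 1)%N%:Z)%R by lia.
  apply: Num.Theory.floor_def.
  have -> : (4%:R * y%:R - p%:R = (4 * y - p)%N%:R :> rat)%R.
    by rewrite natrB ?natrM // ltnW.
  have m_gt0 : (0 < (4 * y - p)%N%:R :> rat)%R by rewrite ltr0n subn_gt0.
  rewrite ler_pdivlMr // ltr_pdivrMr //.
  have -> : ((x - 1)%N%:Z + 1 = x%:Z)%R by lia.
  by rewrite -!pmulrn -!natrM ler_nat ltr_nat le_px.
Qed.

Lemma type_Ib_one_multiple (p n a b c d : nat) :
    0 < a -> 0 < b -> 0 < c -> 0 < d -> n <= p ->
    4 * (a * b * d) = p + n -> n * c = a + p * b ->
    a <= p * b -> a + 4 * b <= 4 * c ->
  exists x y z, type_Ib_solution p x y z.
Proof.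
move=> a0 b0 c0 d0 le_np Ep En le_ab le_abc.
exists (a * b * d), (a * c * d), (p * b * c * d).
have le_bc : b <= c by lia.
apply: type_Ib_of_nat.
- by nia.
- by rewrite !muln_gt0 a0 b0.
- by rewrite leq_mul2r leq_mul2l le_bc !orbT.
- by rewrite -!mulnA (mulnA p) leq_mul2r le_ab orbT.
- have E : 4 * (a * b * d) * c = p * c + (a + p * b) by rewrite Ep mulnDl En.
  transitivity (4 * (a * b * d) * c * (a * c * d * p * b * d)); first by ring.
  by rewrite E; ring.
(* As [n y = a^2 d + p x], the bound reduces to [a^2 d + p <= 4 y], where [p <= 4 a b d] and
   [y = a c d]. *)
- rewrite mulnA Ep.
  have -> : (p + n) * (a * c * d) = p * (a * c * d) + (a + p * b) * (a * d).
    by rewrite -En; ring.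
  have le_d : (a + 4 * b) * (a * d) <= 4 * c * (a * d) by exact: leq_mul.
  have le_p : p <= 4 * (a * b * d) by rewrite Ep leq_addr.
  clear - le_d le_p.
  lia.
Qed.

Lemma type_Ib_two_multiples (p n a b c d : nat) :
    0 < a -> 0 < c -> 0 < d -> a <= b -> 0 < n <= p ->
    4 * (a * b * d) = p + n -> n * c = a + b -> a < 4 * c ->
  exists x y z, type_Ib_solution p x y z.
Proof.
move=> a0 c0 d0 le_ab /andP[n0 le_np] Ep En lt_ac.
exists (a * b * d), (p * a * c * d), (p * b * c * d).
have p0 : 0 < p by lia.
have le_b : b <= p * c by nia.
apply: type_Ib_of_nat => //.
- by nia.
- have -> : p * a * c * d = a * (p * c) * d by ring.
  by rewrite leq_mul2r leq_mul2l le_b !orbT.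
- by rewrite -!mulnA leq_mul2l leq_mul2r le_ab !orbT.
- have E : 4 * (a * b * d) * c = p * c + (a + b) by rewrite Ep mulnDl En.
  transitivity (4 * (a * b * d) * c * (p * a * c * d * p * b * d)); first by ring.
  by rewrite E; ring.
(* Now [n y = p a^2 d + p x], and after division by [p] the bound reads [a^2 d + 1 <= 4 a c d]. *)
- rewrite mulnA Ep.
  have -> : (p + n) * (p * a * c * d) =
      p * (p * a * c * d) + (a + b) * (p * a * d) by rewrite -En; ring.
  have le_d : p * (a * (a * d) + 1) <= p * (4 * c * (a * d)).
    by rewrite leq_mul2l addn1 ltn_mul2r muln_gt0 a0 d0 lt_ac orbT.
  clear - le_d.
  lia.
Qed.

(* Pairs [(m, r)], standing for the class of [r] modulo [m]. *)
Definition solvable_classes : seq (nat * nat) :=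
  [:: (4, 3); (12, 5); (24, 13); (60, 37); (132, 85); (20, 13); (28, 17);
      (56, 41); (56, 33); (44, 29); (132, 109); (220, 189); (660, 589);
      (616, 585); (616, 457)].

Lemma type_Ib_solvable_class (p : nat) :
    has (fun mr => p %% mr.1 == mr.2) solvable_classes ->
  exists x y z, type_Ib_solution p x y z.
Proof.
have split_mod m r : p %% m == r -> exists k, p = m * k + r.
  by move=> /eqP <-; exists (p %/ m); rewrite mulnC -divn_eq.
rewrite /=; do 15?[case/orP]; last by []; move=> /split_mod[k ->].
(* Except in the last class, [n] is a fixed small number with [4] dividing [p + n]; [(p + n) / 4] is
   split as [a b d] so that [n] divides [a + b] or [a + p b], and [c] is the quotient. *)
- by apply: (@type_Ib_two_multiples _ 1 1 1 2 (k + 1)); lia.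
- by apply: (@type_Ib_two_multiples _ 3 1 (3 * k + 2) (k + 1) 1); lia.
(* In this class and the next two, [p] is 1 and [b] is -1 modulo 3, so 3 divides [1 + p b], which is
   quadratic in [k]. *)
- by apply: (@type_Ib_one_multiple _ 3 1 (3 * k + 2)
    (24 * (k * k) + 29 * k + 9) 2); nia.
- by apply: (@type_Ib_one_multiple _ 3 1 (3 * k + 2)
    (60 * (k * k) + 77 * k + 25) 5); nia.
- by apply: (@type_Ib_one_multiple _ 3 1 (3 * k + 2)
    (132 * (k * k) + 173 * k + 57) 11); nia.
- by apply: (@type_Ib_one_multiple _ 7 (k + 1) 1 (3 * k + 2) 5); lia.
- by apply: (@type_Ib_two_multiples _ 7 1 (7 * k + 6) (k + 1) 1); lia.
- by apply: (@type_Ib_two_multiples _ 7 1 (7 * k + 6) (k + 1) 2); lia.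
- by apply: (@type_Ib_two_multiples _ 7 2 (7 * k + 5) (k + 1) 1); lia.
- by apply: (@type_Ib_two_multiples _ 11 1 (11 * k + 10) (k + 1) 1); lia.
- by apply: (@type_Ib_two_multiples _ 11 1 (11 * k + 10) (k + 1) 3); lia.
- by apply: (@type_Ib_two_multiples _ 11 1 (11 * k + 10) (k + 1) 5); lia.
- by apply: (@type_Ib_two_multiples _ 11 1 (11 * k + 10) (k + 1) 15); lia.
- by apply: (@type_Ib_two_multiples _ 31 1 154 5 (k + 1)); lia.
(* Here the quotient [c = 616 / 4] is fixed instead, and [n = (p + 5) / 154] grows with [k]. *)
- by apply: (@type_Ib_one_multiple _ (4 * k + 3) 5 1 154 (31 * k + 23)); lia.
Qed.

Definition prime_classes : seq (nat * nat) :=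
  [:: (2, 0); (3, 0); (5, 0); (7, 0); (11, 0)].

Lemma N_of_modn (r m : nat) :
  N.of_nat (r %% m) = N.modulo (N.of_nat r) (N.of_nat m).
Proof.
case: m => [|m]; first by rewrite modn0 N.mod_0_r.
apply: (N.mod_unique _ _ (N.of_nat (r %/ m.+1))).
  by have := ltn_pmod r (ltn0Sn m); lia.
by rewrite {1}(divn_eq r m.+1); lia.
Qed.

Lemma residue_cover (r : nat) : r < 9240 ->
  has (fun mr => r %% mr.1 == mr.2) (prime_classes ++ solvable_classes) ||
  (r \in exceptional_residues).
Proof.
(* The enumeration is carried out in binary, unary residues being too large. *)
pose toN := map (fun mr => (N.of_nat mr.1, N.of_nat mr.2)).
pose coveredN cls exc n :=
  if has (fun mr : N * N => N.eqb (N.modulo n mr.1) mr.2) cls then true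
  else has (N.eqb n) exc.
(* Since [9240 = 105 * 88], two short ranges reach every residue as [88 k + j]. *)
pose coveredN_all cls exc := all (fun k => all (fun j =>
  coveredN cls exc (N.of_nat k * 88 + N.of_nat j)%num) (iota 0 88)) (iota 0 105).
have cover : coveredN_all (toN (prime_classes ++ solvable_classes))
    (map N.of_nat exceptional_residues) by vm_compute.
move: (prime_classes ++ solvable_classes) exceptional_residues cover.
move=> cls exc cover lt_r.
have k_in : r %/ 88 \in iota 0 105 by rewrite mem_iota ltn_divLR.
have j_in : r %% 88 \in iota 0 88 by rewrite mem_iota ltn_mod.
move: (allP (allP cover _ k_in) _ j_in); rewrite /coveredN.
have -> : (N.of_nat (r %/ 88) * 88 + N.of_nat (r %% 88))%num = N.of_nat r.
  by clear; lia.
rewrite /toN !has_map; case: ifP => [cls_r _|_ /hasP[e e_in /= r_e]].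
  apply/orP; left; apply: etrans cls_r; apply: eq_has => mr /=.
  rewrite -N_of_modn; apply/eqP/N.eqb_spec => [->//|].
  exact: Nnat.Nat2N.inj.
by rewrite (_ : r = e) ?e_in ?orbT //; clear - r_e; lia.
Qed.

Theorem theorem2p6 (p : nat) (p_prime : prime p)
    (p_res : (p %% 9240)%N \notin exceptional_residues) :
  exists x y z : nat, type_Ib_solution p x y z.
Proof.
have cls9240 :
    all (fun mr => mr.1 %| 9240) (prime_classes ++ solvable_classes) by vm_compute.
have : has (fun mr => p %% mr.1 == mr.2) (prime_classes ++ solvable_classes).
  have := residue_cover (ltn_pmod p (isT : 0 < 9240)).
  rewrite (negPf p_res) orbF; apply: etrans; apply: eq_in_has => mr.
  by move=> /(allP cls9240) /modn_dvdm ->.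
clear p_res cls9240; rewrite has_cat => /orP[|]; last exact: type_Ib_solvable_class.
(* What remains is a prime [p] divisible by one of 2, 3, 5, 7, 11, hence equal to it. All but 2 lie
   in a solvable class; for 2 the solution is [(1, 2, 2)]. *)
case/hasP => mr mr_in p_mr.
have /andP[/eqP r0 pr_q] := allP
  (isT : all (fun mr => (mr.2 == 0) && prime mr.1) prime_classes) _ mr_in.
have Ep : mr.1 = p by apply/eqP; rewrite -dvdn_prime2 // /dvdn (eqP p_mr) r0.
have := allP (isT : all (fun mr => (mr.1 == 2) ||
  has (fun ns => mr.1 %% ns.1 == ns.2) solvable_classes) prime_classes) _ mr_in.
rewrite Ep => /orP[/eqP-> |]; last exact: type_Ib_solvable_class.
by apply: (@type_Ib_two_multiples _ 2 1 1 1 1).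
Qed.
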